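(* Let $p$ be a prime and $G$ a finite Abelian $p$-group. Then the $\mathbb Z$-module $K(G,C_p)$ of relative Brauer $(G,C_p)$-relations is generated by the elements of the form $\mathrm{Ind}_K^{G\times C_p}\mathrm{Inf}_{K/N}^K(\Theta')$, where $N\le K\le G\times C_p$ are subgroups with $K/N\cong C_p\times C_p\times C_p$, $\Theta'\in K(K/N)$ is a Brauer relation of $K/N$, and $\mathrm{Ind}_K^{G\times C_p}\mathrm{Inf}_{K/N}^K(\Theta')\in B(G,C_p)$. Equivalently, $K'(G,C_p)=K(G,C_p)$.
   Context: $C_p$ is the cyclic group of prime order $p$, $\Gamma=G\times C_p$. For a finite group $\Pi$, the Burnside ring $B(\Pi)$ is the Grothendieck group of finite $\Pi$-sets (relations $[X\sqcup Y]=[X]+[Y]$); it is free Abelian with basis the classes $[\Pi/S]$, $S$ running over subgroups up to conjugacy; since $\Gamma$ is Abelian we write elements of $B(\Gamma)$ as integral combinations $\sum n_i S_i$ of subgroups $S_i\le\Gamma$. $R_{\mathbb Q}(\Pi)$ is the rational representation ring and $f_\Pi:B(\Pi)\to R_{\mathbb Q}(\Pi)$, $[X]\mapsto[\mathbb Q[X]]$; its kernel $K(\Pi)$ is the module of Brauer relations of $\Pi$. For $K\le G$ and a homomorphism $\rho:K\to C_p$, the graph is $K\times\rho=\{(k,\rho(k)):k\in K\}\le\Gamma$. The relative Burnside module $B(G,C_p)\subset B(\Gamma)$ is the subgroup spanned by all graphs $K\times\rho$ (equivalently the Grothendieck group of finite $(G,C_p)$-bisets that are free as right $C_p$-sets).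 The relative Brauer relations are $K(G,C_p)=K(\Gamma)\cap B(G,C_p)$ (the kernel of $f_\Gamma$ restricted to $B(G,C_p)$). For subgroups $N\le K\le\Gamma$, $\mathrm{Ind}_K^\Gamma\mathrm{Inf}_{K/N}^K:B(K/N)\to B(\Gamma)$ is the linear map sending the basis element $S/N$ ($N\le S\le K$) to $S$; it maps $K(K/N)$ into $K(\Gamma)$. $K'(G,C_p)\subseteq K(G,C_p)$ denotes the submodule generated by all elements of $K(G,C_p)$ of the form $\mathrm{Ind}_K^{\Gamma}\mathrm{Inf}_{K/N}^K(\Theta')$ with $K/N\cong C_p\times C_p\times C_p$ and $\Theta'\in K(K/N)$. *)

(* Defs.v *)
From HB Require Import structures.
From mathcomp Require Import all_boot all_order all_fingroup all_algebra all_solvable all_field all_character.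
Set Implicit Arguments. Unset Strict Implicit. Unset Printing Implicit Defensive.
Import GRing.Theory Num.Theory.
Local Open Scope group_scope.

(* Formal Z-combinations of subsets of T; an element of the Burnside ring
   B(H) is represented by such a combination supported on subgroups of H,
   standing for  sum_S theta(S) [H/S]. *)
Definition zcomb (T : finGroupType) := {ffun {set T} -> int}.

Definition in_burnside (T : finGroupType) (H : {set T}) (theta : zcomb T) :=
  forall S : {set T}, theta S != 0%R -> group_set S && (S \subset H).

(* f_H(theta) = sum_S theta(S) [Q[H/S]]; we identify the class of Q[H/S]
   in R_Q(H) with its character, the permutation character 'Ind[H,S] 1. *)
Definition perm_char_comb (T : finGroupType) (H : {group T}) (theta : zcomb T)
  : 'CF(H) :=
  (\sum_(S : {group T} | S \subset H) (theta S)%:~R *: 'Ind[H, S] (1 : 'CF(S)))%R.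

Definition brauer_rel (T : finGroupType) (H : {group T}) (theta : zcomb T) :=
  in_burnside H theta /\ perm_char_comb H theta = 0%R.

Definition is_graph (gT cT : finGroupType) (G : {set gT}) (C : {set cT})
  (S : {set (gT * cT)%type}) :=
  exists (K : {group gT}) (rho : {morphism K >-> cT}),
    [/\ K \subset G, rho @* K \subset C & S = [set (k, rho k) | k in K]].

Definition in_rel_burnside (gT cT : finGroupType) (G : {set gT}) (C : {set cT})
  (theta : zcomb (gT * cT)%type) :=
  forall S, theta S != 0%R -> is_graph G C S.

Definition rel_brauer (gT cT : finGroupType) (G : {group gT}) (C : {group cT})
  (theta : zcomb (gT * cT)%type) :=
  brauer_rel (setX G C) theta /\ in_rel_burnside G C theta.

(* Ind_K^Gamma Inf_{K/N}^K : B(K/N) -> B(Gamma), S/N |-> S (N <= S <= K). *)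
Definition ind_inf (T : finGroupType) (K N : {set T})
  (theta' : zcomb (coset_of N)) : zcomb T :=
  [ffun S : {set T} =>
     if [&& group_set S, N \subset S & S \subset K] then theta' (S / N) else 0%R].

Definition kprime_gen (gT cT : finGroupType) (G : {group gT}) (C : {group cT})
  (theta : zcomb (gT * cT)%type) :=
  rel_brauer G C theta /\
  exists (K N : {group (gT * cT)%type}),
    [/\ N \subset K, K \subset setX G C,
        (K / N)%g \isog setX (setX C C) C &
        exists theta' : zcomb (coset_of N),
          brauer_rel (K / N)%G theta' /\ theta = @ind_inf _ K N theta'].

Definition in_zspan (V : zmodType) (P : V -> Prop) (v : V) :=
  exists (n : nat) (c : 'I_n -> int) (g : 'I_n -> V),
    (forall i, P (g i)) /\ v = (\sum_(i < n) g i *~ c i)%R.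

(* Main.v *)
(* Put H = G x E with E = 1 x C.  Graphs are the subgroups S of H with
   S :&: E = 1, and theta is a Brauer relation iff the sum of theta over the
   subgroups of L vanishes for every L with H / L cyclic.

   Call a graph basic if H / S is cyclic, or if S <= G and G / S is cyclic.
   Modulo the C_p^3-relations every graph is a combination of basic ones, by
   descending induction on the order:
   - if S <= G and G / S is not cyclic, there is S <= K <= G with
     K / S = C_p x C_p, and the relation of K / S expresses S by larger graphs;
   - if S is not contained in G and H / S is not cyclic, S has index p in some
     graph R, and a relation of R E / (S :&: G) = C_p^3 expresses the difference
     of S and S E :&: G by larger graphs.
   Basic graphs are linearly independent modulo Brauer relations: in a relation
   u supported on them, take S minimal with u S != 0.  If H / S is cyclic, the
   sum below L = S is u S; otherwise the sum below L = S E is u S plus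
   coefficients u X with H / X cyclic and X of the same order as S, which vanish
   by the first case. *)
Require Import Defs.
From HB Require Import structures.
From mathcomp Require Import all_boot all_order all_fingroup all_algebra all_solvable all_field all_character.
From mathcomp Require Import ring.
Set Implicit Arguments. Unset Strict Implicit. Unset Printing Implicit Defensive.
Import GRing.Theory Num.Theory.
Local Open Scope group_scope.

(** * Brauer relations of abelian p-groups through subgroup sums *)

Definition subsum (T : finGroupType) (theta : zcomb T) (L : {set T}) : int :=
  (\sum_(S : {group T} | S \subset L) theta S)%R.

(** By Frobenius reciprocity, ['Ind[H, S] 1] contains a linear character once if [S] lies in its
    kernel and not at all otherwise. *)
Lemma cfdot_perm_char_comb (T : finGroupType) (H : {group T})
    (theta : zcomb T) (i : Iirr H) : abelian H ->
  ('[perm_char_comb H theta, 'chi_i] = (subsum theta (cfker 'chi_i))%:~R)%R.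
Proof.
move=> abH; have lin_i: ('chi_i)%R \is a linear_char by apply/char_abelianP.
rewrite /perm_char_comb cfdot_suml /subsum rmorph_sum /=.
rewrite big_mkcond [RHS]big_mkcond /=; apply: eq_bigr => S _.
have [sSH | nsSH] := boolP (S \subset H); last first.
  case: ifP => // sSk; case/negP: nsSH; exact: subset_trans sSk (cfker_sub _).
have/lin_char_irr/irrP[j Dj] := cfRes_lin_char S lin_i.
rewrite cfdotZl -Frobenius_reciprocity Dj -irr0 cfdot_irr.
rewrite eq_sym -subGcfker -Dj cfker_Res ?irr_char // subsetI subxx /=.
by case: ifP => _ /=; rewrite ?mulr1 ?mulr0.
Qed.

(** The centre of an irreducible character is cyclic modulo the kernel, and in an abelian group this
    centre is the whole group. *)
Lemma cyclic_quo_cfker (T : finGroupType) (H : {group T}) (i : Iirr H) :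
  abelian H -> cyclic (H / cfker ('chi_i)%R).
Proof.
move=> abH; apply: cyclicS (cfcenter_cyclic ('chi_i)%R).
apply: quotientS; apply: subset_trans (_ : 'Z(H) \subset _).
  by rewrite subsetI subxx.
by rewrite -cap_cfcenter_irr; apply: bigcap_inf.
Qed.

(** The p-group [H / L] has cyclic centre, hence a faithful irreducible character; its inflation to
    [H] has kernel exactly [L]. *)
Lemma cyclic_quo_cfkerP (T : finGroupType) (p : nat) (H L : {group T}) :
  abelian H -> p.-group H -> L \subset H -> cyclic (H / L) ->
  exists i : Iirr H, cfker ('chi_i)%R = L.
Proof.
move=> abH pH sLH cycHL; have nsLH : L <| H by rewrite -sub_abelian_normal.
have [|i faith_i] := pgroup_cyclic_faithful (quotient_pgroup L pH).
  exact: cyclicS (center_sub _) cycHL.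
exists (mod_Iirr i); rewrite mod_IirrE // cfker_morph ?normal_norm //.
move: faith_i; rewrite cfaithfulE => /trivgP ->.
by rewrite (setIidPr _) -/(_ :&: _) -?kerE ?ker_coset.
Qed.

(* A rational representation of an abelian group is determined by the
   multiplicities of the linear characters in it, and chi occurs in Q[H/S]
   exactly when S lies in the kernel of chi. *)
Lemma brauer_relP (T : finGroupType) (p : nat) (H : {group T})
    (theta : zcomb T) :
  abelian H -> p.-group H -> in_burnside H theta ->
  brauer_rel H theta <->
  (forall L : {group T}, L \subset H -> cyclic (H / L) -> subsum theta L = 0%R).
Proof.
move=> abH pH Bth; split=> [[_ f0] L sLH cycL | f0].
  have [i <-] := cyclic_quo_cfkerP abH pH sLH cycL; apply/eqP.
  by rewrite -(intr_eq0 algC) -cfdot_perm_char_comb // f0 cfdot0l.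
split=> //; rewrite [LHS]cfun_sum_cfdot big1 // => i _.
by rewrite cfdot_perm_char_comb // f0 ?cfker_sub ?cyclic_quo_cfker ?scale0r.
Qed.

(** * Relations inflated from a quotient *)

Lemma subsum_interval (T : finGroupType) (theta : zcomb T) (K N : {set T})
    (L : {set T}) :
  (forall S, theta S != 0%R -> [&& group_set S, N \subset S & S \subset K]) ->
  subsum theta L =
  (\sum_(S : {group T} | [&& S \subset L, N \subset S & S \subset K]) theta S)%R.
Proof.
move=> supp; rewrite /subsum big_mkcond [RHS]big_mkcond; apply: eq_bigr => S _ /=.
case: (S \subset L) => //=; case: ifPn => // nNK.
by apply/eqP; apply: contraR nNK => /supp/and3P[_ -> ->].
Qed.

Lemma subsum_quotient (T : finGroupType) (theta : zcomb T) (K N : {group T})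
    (L : {group coset_of N}) :
  N <| K -> L \subset K / N ->
  subsum [ffun X : {set coset_of N} =>
    if group_set X && (X \subset K / N) then theta (coset N @*^-1 X) else 0%R] L
  = (\sum_(S : {group T} | [&& S \subset coset N @*^-1 L, N \subset S
                             & S \subset K]) theta S)%R.
Proof.
move=> nsNK sLK.
rewrite (reindex_onto (fun Y : {group coset_of N} => (coset N @*^-1 Y)%G)
   (fun S : {group T} => (S / N)%G)) /=; last first.
  move=> S /and3P[_ sNS sSK]; apply/val_inj; rewrite /= quotientGK //.
  exact: normalS nsNK.
rewrite /subsum; apply: eq_big => [Y | Y sYL].
  rewrite cosetpreSK sub_cosetpre /= -(quotientGK nsNK) cosetpreSK.
  rewrite -val_eqE /= cosetpreK eqxx andbT.
  by case: (boolP (Y \subset L)) => //= /subset_trans->.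
by rewrite ffunE groupP (subset_trans sYL).
Qed.

(** This recognises inflated relations by computing in the interval from [N] to [K] only: the
    correspondence theorem turns the sums there into the sums for [K / N]. *)
Lemma ind_inf_brauer (T : finGroupType) (p : nat) (H K N : {group T})
    (theta : zcomb T) :
  abelian H -> p.-group H -> N \subset K -> K \subset H ->
  (forall S, theta S != 0%R -> [&& group_set S, N \subset S & S \subset K]) ->
  (forall L : {group T}, N \subset L -> L \subset K -> cyclic (K / L) ->
     subsum theta L = 0%R) ->
  brauer_rel H theta /\
  exists theta' : zcomb (coset_of N),
    brauer_rel (K / N)%G theta' /\ theta = @ind_inf _ K N theta'.
Proof.
move=> abH pH sNK sKH supp f0; have abK := abelianS sKH abH.
have nNK : K \subset 'N(N) := sub_abelian_norm abK sNK.
split.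
  apply/(brauer_relP abH pH) => [S /supp/and3P[-> _ sSK] | L sLH cycL].
    exact: subset_trans sSK sKH.
  rewrite (subsum_interval _ supp).
  have [sNL | nsNL] := boolP (N \subset L); last first.
    rewrite big1 // => S /and3P[sSL sNS _].
    by case/negP: nsNL; exact: subset_trans sSL.
  (* The support lies below [K], so [L] may be cut down to [K :&: L]; the quotient of [K] by it
     embeds in [H / L] and is therefore cyclic. *)
  transitivity (subsum theta (K :&: L)%G).
    rewrite (subsum_interval _ supp); apply: eq_bigl => S; rewrite subsetI.
    by case: (S \subset K); rewrite ?andbF.
  apply: f0; rewrite ?subsetIl //= ?subsetI ?sNK //.
  have nLK: K \subset 'N(L) by exact: subset_trans sKH (sub_abelian_norm abH sLH).
  by rewrite setIC (isog_cyclic (second_isog nLK)) (cyclicS (quotientS _ sKH)).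
pose theta' : zcomb (coset_of N) := [ffun X : {set coset_of N} =>
  if group_set X && (X \subset K / N) then theta (coset N @*^-1 X) else 0%R].
exists theta'; split; last first.
  apply/ffunP=> S; rewrite !ffunE; case: ifPn => [/and3P[gS sNS sSK] | nS].
    rewrite -[S]/(gval (Group gS)) groupP quotientS // quotientGK //.
    by rewrite /normal sNS (subset_trans sSK).
  by apply/eqP; apply: contraR nS => /supp.
apply/(brauer_relP (quotient_abelian N abK) (quotient_pgroup N (pgroupS sKH pH))).
  by move=> X; rewrite ffunE; case: ifP => // _; rewrite eqxx.
move=> L sLK cycL; rewrite subsum_quotient /normal ?sNK // -(subsum_interval _ supp).
have nsNK: N <| K by rewrite /normal sNK.
have sLK' : coset N @*^-1 L \subset K.
  by rewrite -(quotientGK nsNK) cosetpreSK.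
rewrite (f0 (coset N @*^-1 L)%G) ?sub_cosetpre //=.
rewrite -(isog_cyclic (third_isog _ nsNK _)) ?sub_cosetpre //.
  by rewrite cosetpreK.
by rewrite -sub_abelian_normal.
Qed.

(** * Single-subgroup combinations and linearity of subgroup sums *)

Definition zsingle (T : finGroupType) (S : {set T}) : zcomb T :=
  [ffun X : {set T} => ((X == S)%:R)%R].

Lemma zsingle_neq0 (T : finGroupType) (S X : {set T}) :
  (zsingle S X != 0)%R = (X == S).
Proof. by rewrite ffunE; case: (X == S); rewrite /= ?oner_eq0 ?eqxx. Qed.

Lemma zcomb_single (T : finGroupType) (theta : zcomb T) :
  theta = (\sum_S zsingle S *~ theta S)%R.
Proof.
apply/ffunP=> X; rewrite sum_ffunE (bigD1 X) //= big1 => [|S /negPf nSX].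
  by rewrite ffunMzE ffunE eqxx addr0 mulrzz mul1r.
by rewrite ffunMzE ffunE eq_sym nSX mul0rz.
Qed.

Lemma subsum0 (T : finGroupType) (L : {set T}) : subsum 0%R L = 0%R.
Proof. by rewrite /subsum big1 // => S _; rewrite ffunE. Qed.

Lemma subsumD (T : finGroupType) (L : {set T}) (u v : zcomb T) :
  (subsum (u + v) L = subsum u L + subsum v L)%R.
Proof. by rewrite /subsum -big_split; apply: eq_bigr => S _; rewrite ffunE. Qed.

Lemma subsumN (T : finGroupType) (L : {set T}) (u : zcomb T) :
  (subsum (- u) L = - subsum u L)%R.
Proof. by rewrite /subsum -sumrN; apply: eq_bigr => S _; rewrite ffunE. Qed.

Lemma subsumMz (T : finGroupType) (L : {set T}) (u : zcomb T) (c : int) :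
  (subsum (u *~ c) L = subsum u L *~ c)%R.
Proof. by rewrite /subsum mulrz_suml; apply: eq_bigr => S _; rewrite ffunMzE. Qed.

Lemma subsum_sum (T : finGroupType) (L : {set T}) (I : Type) (r : seq I)
    (P : pred I) (F : I -> zcomb T) :
  subsum (\sum_(i <- r | P i) F i)%R L = (\sum_(i <- r | P i) subsum (F i) L)%R.
Proof. exact: (big_morph _ (subsumD L) (subsum0 L)). Qed.

Lemma subsum_single (T : finGroupType) (S : {group T}) (L : {set T}) :
  subsum (zsingle S) L = ((S \subset L)%:R)%R.
Proof.
rewrite /subsum; case sSL: (S \subset L); last first.
  rewrite big1 // => X sXL; rewrite ffunE; case: eqP => // DX.
  by rewrite -DX sXL in sSL.
rewrite (bigD1 S) //= ffunE eqxx big1 ?addr0 // => X /andP[_].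
by rewrite -val_eqE ffunE => /negPf /= ->.
Qed.

Lemma supp_sum (T : finGroupType) (I : eqType) (r : seq I)
    (P : pred I) (F : I -> zcomb T) (X : {set T}) :
  ((\sum_(i <- r | P i) F i) X != 0)%R -> has (fun i => P i && (F i X != 0%R)) r.
Proof.
apply: contraR => /hasPn nF; rewrite sum_ffunE big_seq_cond big1 // => i.
by case/andP=> /nF; rewrite negb_and negbK => /orP[/negPf-> | /eqP].
Qed.

(** * Elementary abelian quotients and their lines *)

Lemma abelem_quotient (T : finGroupType) (p : nat) (K N : {group T}) :
  prime p -> abelian K -> N \subset K -> (forall x, x \in K -> x ^+ p \in N) ->
  p.-abelem (K / N).
Proof.
move=> p_pr abK sNK pK; apply/(abelemP p_pr); split.
  exact: quotient_abelian.
move=> _ /morphimP[x nNx Kx ->]; rewrite -morphX //.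
by apply: coset_id; apply: pK.
Qed.

(** A cyclic elementary abelian group has order 1 or [p], so a relation of [K / N] need only be
    tested on [K] and its subgroups of index [p]. *)
Lemma abelem_cyclic_quotient (T : finGroupType) (p : nat) (K N L : {group T}) :
  prime p -> abelian K -> p.-abelem (K / N) -> N \subset L -> L \subset K ->
  cyclic (K / L) -> L = K \/ #|K| = (p * #|L|)%N.
Proof.
move=> p_pr abK abelK sNL sLK cycL.
have sNK := subset_trans sNL sLK.
have iso: (K / N) / (L / N) \isog K / L.
  by apply: third_isog; rewrite // -sub_abelian_normal.
have abelL: p.-abelem (K / L).
  by rewrite -(isog_abelem iso); apply: quotient_abelem.
move: cycL; rewrite (abelem_cyclic abelL) => le1.
have cKL: #|K / L| = (p ^ logn p #|K / L|)%N.
  exact: card_pgroup (abelem_pgroup abelL).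
have cK: #|K| = (#|K / L| * #|L|)%N.
  by rewrite card_quotient ?sub_abelian_norm // mulnC Lagrange.
case: (logn _ _) le1 cKL => [|[|]] // _ cKL; [left | right].
  by apply/val_inj/eqP; rewrite eqEcard sLK cK cKL mul1n leqnn.
by rewrite cK cKL expn1.
Qed.

Lemma prime_index_max (T : finGroupType) (p : nat) (K X Y : {group T}) :
  prime p -> K \subset X -> X \subset Y -> #|Y| = (p * #|K|)%N ->
  X :=: K \/ X :=: Y.
Proof.
move=> p_pr sKX sXY cY; have /dvdnP[k Dk] := cardSg sKX.
have : k %| p by rewrite -(@dvdn_pmul2r #|K|) // -Dk -cY cardSg.
case/primeP: p_pr => _ /[apply] /orP[/eqP k1 | /eqP kp]; [left | right].
  by apply/esym/eqP; rewrite eqEcard sKX Dk k1 mul1n leqnn.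
by apply/eqP; rewrite eqEcard sXY Dk kp cY leqnn.
Qed.

(** When [K / A] is elementary abelian, these are the preimages in [K] of its lines. *)
Definition covers (T : finGroupType) (p : nat) (K A : {set T}) :
    pred {group T} :=
  [pred X : {group T} | [&& A \subset X, X \subset K & #|X| == (p * #|A|)%N]].

Lemma covers_join (T : finGroupType) (p : nat) (K A : {group T}) x :
  prime p -> abelian K -> A \subset K -> x \in K -> x \notin A -> x ^+ p \in A ->
  covers p K A (A <*> <[x]>)%G.
Proof.
move=> p_pr abK sAK Kx nAx Axp.
have nAx' : x \in 'N(A) := subsetP (sub_abelian_norm abK sAK) x Kx.
have oAx : #[coset A x] = p.
  have : #[coset A x] %| p by rewrite order_dvdn -morphX //= coset_id.
  case/primeP: (p_pr) => _ /[apply] /orP[|/eqP //].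
  rewrite order_eq1 => /eqP/coset_idr; rewrite nAx'.
  by move/(_ isT) => Ax; rewrite Ax in nAx.
rewrite /covers inE joing_subl join_subG sAK cycle_subG Kx /=.
rewrite -(Lagrange (joing_subl A <[x]>)) -card_quotient; last first.
  by rewrite join_subG normG cycle_subG.
by rewrite quotientYidl ?cycle_subG // quotient_cycle // -orderE oAx mulnC.
Qed.

(** Double counting of [K :\: Q]: each element [x] of it lies in exactly one cover of [A] other than
    [Q], namely [A <*> <[x]>], and each such cover has [#|Q| - #|A|] elements outside [Q]. The
    number of covers thus depends on orders only, which balances the two sums of [pencil_rel]. *)
Lemma card_covers (T : finGroupType) (p : nat) (K A Q : {group T}) :
  prime p -> abelian K -> (forall x, x \in K -> x ^+ p \in A) ->
  covers p K A Q ->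
  (#|[pred X | covers p K A X & X != Q]| * (#|Q| - #|A|) = #|K| - #|Q|)%N.
Proof.
move=> p_pr abK pK /and3P[sAQ sQK /eqP cQ].
have sAK := subset_trans sAQ sQK.
have covI X x : covers p K A X -> x \in X -> x \notin A -> X = (A <*> <[x]>)%G.
  case/and3P=> sAX sXK /eqP cX Xx nAx; apply/esym/val_inj/eqP.
  rewrite eqEcard /= join_subG sAX cycle_subG Xx /= cX.
  have sAx : A <*> <[x]> \subset X by rewrite join_subG sAX cycle_subG.
  have [/= DA | /= ->] := prime_index_max p_pr (joing_subl A <[x]>) sAx cX.
    by case/negP: nAx; rewrite -cycle_subG -DA joing_subr.
  by rewrite cX.
have in1 x : x \in K :\: Q ->
    (\sum_(X | covers p K A X && (X != Q)) (x \in X) = 1)%N.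
  case/setDP=> Kx nQx; have nAx: x \notin A by apply: contra nQx; apply/subsetP.
  have cX0 : covers p K A (A <*> <[x]>)%G by apply: covers_join => //; apply: pK.
  rewrite (bigD1 (A <*> <[x]>)%G) /=; last first.
    rewrite cX0; apply: contraNneq nQx => <- /=.
    by rewrite -cycle_subG joing_subr.
  rewrite -cycle_subG joing_subr big1 // => X /andP[/andP[cX _] nX].
  by apply/eqP; rewrite eqb0; apply: contra nX => Xx; rewrite (covI X x).
have: (\sum_(x in K :\: Q) 1 = #|K| - #|Q|)%N.
  by rewrite sum1_card cardsD (setIidPr sQK).
rewrite -(eq_bigr _ in1) exchange_big /= => <-.
rewrite -sum_nat_const; apply: eq_big => [X | X /andP[cX nXQ]]; first by rewrite inE.
have /and3P[sAX sXK /eqP cardX] := cX.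
have defA : X :&: Q = A.
  have sAXQ : A \subset X :&: Q by rewrite subsetI sAX.
  have [// | DX] :=
    prime_index_max p_pr sAXQ (subsetIl X Q) cardX.
  case/eqP: nXQ; apply/val_inj/eqP; rewrite eqEcard cardX cQ leqnn andbT.
  by apply/setIidPl; rewrite -[RHS]DX.
have -> : (#|Q| - #|A| = #|X :\: Q|)%N by rewrite cardsD defA cardX cQ.
rewrite -sum1_card big_mkcond [RHS]big_mkcond; apply: eq_bigr => x _.
rewrite !inE; case: (x \in Q) => //=; case Xx: (x \in X); last by case: ifP.
by rewrite (subsetP sXK).
Qed.

(** * Integral spans *)

Lemma in_zspan0 (V : zmodType) (P : V -> Prop) : in_zspan P 0%R.
Proof.
exists 0%N, (fun=> 0%R), (fun=> 0%R); split=> [[]|]; first by [].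
by rewrite big_ord0.
Qed.

Lemma in_zspan_gen (V : zmodType) (P : V -> Prop) v : P v -> in_zspan P v.
Proof.
by move=> Pv; exists 1%N, (fun=> 1%R), (fun=> v); split=> //; rewrite big_ord1.
Qed.

Lemma in_zspanD (V : zmodType) (P : V -> Prop) (u v : V) :
  in_zspan P u -> in_zspan P v -> in_zspan P (u + v)%R.
Proof.
move=> [m [c [g [Pg ->]]]] [n [d [h [Ph ->]]]].
pose pick X (a : 'I_m -> X) (b : 'I_n -> X) i :=
  match split i with inl j => a j | inr k => b k end.
exists (m + n)%N, (pick _ c d), (pick _ g h); split.
  by move=> i; rewrite /pick; case: (split i).
rewrite big_split_ord /=; congr (_ + _)%R; apply: eq_bigr => i _; rewrite /pick.
  by rewrite (unsplitK (inl i)).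
by rewrite (unsplitK (inr i)).
Qed.

Lemma in_zspanMz (V : zmodType) (P : V -> Prop) (u : V) (a : int) :
  in_zspan P u -> in_zspan P (u *~ a)%R.
Proof.
move=> [m [c [g [Pg ->]]]]; exists m, (fun i => c i * a)%R, g; split=> //.
by rewrite mulrz_suml; apply: eq_bigr => i _; rewrite mulrzA.
Qed.

Lemma in_zspan_mono (V : zmodType) (P Q : V -> Prop) (u : V) :
  (forall v, P v -> Q v) -> in_zspan P u -> in_zspan Q u.
Proof.
by move=> PQ [m [c [g [Pg ->]]]]; exists m, c, g; split=> // i; apply: PQ.
Qed.

(** A noncyclic abelian p-group has rank at least 2, so it contains a copy of C_p x C_p; [K] is the
    preimage of one. *)
Lemma noncyclic_quotient_plane (T : finGroupType) (p : nat) (A N : {group T}) :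
  prime p -> abelian A -> p.-group A -> N \subset A -> ~~ cyclic (A / N) ->
  exists K : {group T}, [/\ N \subset K, K \subset A,
    forall x, x \in K -> x ^+ p \in N & #|K| = (p ^ 2 * #|N|)%N].
Proof.
move=> p_pr abA pA sNA ncyc.
have nsNA : N <| A by rewrite -sub_abelian_normal.
have : (2 <= 'r_p(A / N))%N.
  rewrite -(rank_pgroup (quotient_pgroup N pA)) ltnNge.
  by rewrite -abelian_rank1_cyclic ?quotient_abelian.
case/p_rank_geP=> F /pnElemPcard[sFA abelF cF].
have sKA : coset N @*^-1 F \subset A.
  by rewrite -(quotientGK nsNA) cosetpreSK.
have nNA := normal_norm nsNA.
exists (coset N @*^-1 F)%G; split; rewrite ?sub_cosetpre //=; last first.
  by rewrite card_cosetpre cF mulnC.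
move=> x Kx; have nNx := subsetP nNA x (subsetP sKA x Kx).
apply: coset_idr; first by rewrite groupX.
have [_ expF] := abelemP p_pr abelF.
by rewrite morphX //= expF // -(cosetpreK F) mem_quotient.
Qed.

(** * Graphs in a direct product with a group of order p *)

Section SplitGroup.

Variables (T : finGroupType) (p : nat) (H G E : {group T}).
Hypotheses (p_pr : prime p) (abH : abelian H) (pH : p.-group H).
Hypotheses (defH : G \x E = H) (cardE : #|E| = p).

(** For [E] = 1 x C these are the graphs K x rho of the theorem, by [is_graphP]. *)
Definition graph (S : {set T}) := [&& group_set S, S \subset H & S :&: E == 1].

Definition graph_rel (theta : zcomb T) :=
  brauer_rel H theta /\ (forall S, theta S != 0%R -> graph S).

(** Elementary abelian of order p^3 stands for C_p x C_p x C_p; [abelem_cube] gives back the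
    isomorphism. *)
Definition graph_gen (theta : zcomb T) :=
  graph_rel theta /\
  exists K N : {group T},
    [/\ N \subset K, K \subset H, p.-abelem (K / N) /\ #|K / N| = (p ^ 3)%N &
        exists theta' : zcomb (coset_of N),
          brauer_rel (K / N)%G theta' /\ theta = @ind_inf _ K N theta'].

Let sGH : G \subset H. Proof. by case/dprodP: defH => _ <- _ _; exact: mulG_subl. Qed.
Let sEH : E \subset H. Proof. by case/dprodP: defH => _ <- _ _; exact: mulG_subr. Qed.
Let tiGE : G :&: E = 1. Proof. by case/dprodP: defH. Qed.

Lemma sub_graph (S : {group T}) : S \subset G -> graph S.
Proof.
move=> sSG; rewrite /graph groupP (subset_trans sSG) //=.
by rewrite -subG1 -tiGE setSI.
Qed.

(** As [E] has order [p], taking p-th powers kills the [E] component. *)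
Lemma expgG x : x \in H -> x ^+ p \in G.
Proof.
case/dprodP: (defH) => _ <- cGE _ /mulsgP[g e Gg Ee ->].
have cge : commute g e by apply/esym/(centsP cGE).
rewrite expgMn // (_ : e ^+ p = 1) ?mulg1 ?groupX //.
by apply/eqP; rewrite -order_dvdn -cardE order_dvdG.
Qed.

Lemma expg_mulE (K : {group T}) x :
  K \subset H -> x \in K <*> E -> x ^+ p \in [set k ^+ p | k in K].
Proof.
move=> sKH; have cKE : E \subset 'C(K).
  exact: subset_trans sEH (centsS sKH abH).
rewrite cent_joinEr // => /mulsgP[k e Kk Ee ->].
have cke : commute k e by apply/esym/(centsP cKE).
rewrite expgMn // (_ : e ^+ p = 1) ?mulg1; first exact: imset_f.
by apply/eqP; rewrite -order_dvdn -cardE order_dvdG.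
Qed.

Lemma card_joinE (K : {group T}) : graph K -> #|K <*> E| = (p * #|K|)%N.
Proof.
case/and3P=> _ sKH /eqP tiKE; rewrite cent_joinEr; last first.
  exact: subset_trans sEH (centsS sKH abH).
by rewrite TI_cardMg // cardE mulnC.
Qed.

(** Working form of [graph_gen]: by [abelem_cyclic_quotient], the tests for [K / N] reduce to [K]
    and its maximal subgroups above [N]. *)
Lemma graph_gen_intro (K N : {group T}) (theta : zcomb T) :
  N \subset K -> K \subset H -> (forall x, x \in K -> x ^+ p \in N) ->
  #|K| = (p ^ 3 * #|N|)%N ->
  (forall S, theta S != 0%R -> [&& graph S, N \subset S & S \subset K]) ->
  subsum theta K = 0%R ->
  (forall L : {group T}, N \subset L -> L \subset K -> #|K| = (p * #|L|)%N ->
     subsum theta L = 0%R) ->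
  graph_gen theta.
Proof.
move=> sNK sKH pK cK supp f0 f1; have abK := abelianS sKH abH.
have abelK := abelem_quotient p_pr abK sNK pK.
have supp' S : theta S != 0%R -> [&& group_set S, N \subset S & S \subset K].
  by case/supp/and3P=> /and3P[-> _ _] -> ->.
have [|br ex] := ind_inf_brauer abH pH sNK sKH supp'.
  move=> L sNL sLK cycL.
  have [-> //|cL] := abelem_cyclic_quotient p_pr abK abelK sNL sLK cycL.
  exact: f1.
split; first by split=> // S /supp/and3P[].
exists K, N; split=> //; split=> //.
by rewrite card_quotient ?sub_abelian_norm // -divgS // cK mulnK.
Qed.

(* As #|covers p K N| = p + 1, this is the relation 1 - sum of lines + p * plane
   of K / N = C_p x C_p; it is inflated from K E / N = C_p^3. *)
Lemma plane_rel (N K : {group T}) :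
  N \subset K -> K \subset G -> (forall x, x \in K -> x ^+ p \in N) ->
  #|K| = (p ^ 2 * #|N|)%N ->
  graph_gen (zsingle N - \sum_(P | covers p K N P) zsingle P
             + zsingle K *~ (#|covers p K N|%:Z - 1))%R.
Proof.
move=> sNK sKG pK cK.
have sKH := subset_trans sKG sGH; have abK := abelianS sKH abH.
have grK := sub_graph sKG.
have subsumE (L : {group T}) : N \subset L ->
    subsum (zsingle N - \sum_(P | covers p K N P) zsingle P
             + zsingle K *~ (#|covers p K N|%:Z - 1))%R L =
    (1 - \sum_(P | covers p K N P) (P \subset L)%:R
      + (K \subset L)%:R * (#|covers p K N|%:Z - 1))%R.
  move=> sNL; rewrite !subsumD subsumN subsumMz subsum_sum !subsum_single sNL.
  rewrite -mulrzz; congr (_ - _ + _)%R; apply: eq_bigr => P _.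
  exact: subsum_single.
apply: (@graph_gen_intro (K <*> E) N).
- exact: subset_trans sNK (joing_subl K E).
- by rewrite join_subG sKH.
- by move=> x /(expg_mulE sKH)/imsetP[k /pK Nk ->].
- by rewrite card_joinE // cK mulnA -expnS.
- have aux (S : {group T}) : N \subset S -> S \subset K ->
      [&& graph S, N \subset S & S \subset K <*> E].
    move=> sNS sSK; rewrite sNS (sub_graph (subset_trans sSK sKG)) /=.
    exact: subset_trans sSK (joing_subl _ _).
  move=> S; rewrite !ffunE.
  have [-> _ | nSN] := eqVneq S N; first exact: aux.
  have [-> _ | nSK] := eqVneq S K; first exact: aux.
  rewrite add0r ffunMzE ffunE (negPf nSK) mul0rz addr0 oppr_eq0.
  case/supp_sum/hasP=> P _ /andP[/and3P[sNP sPK _]].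
  by rewrite zsingle_neq0 => /eqP->; apply: aux.
(* Every term lies below [K <*> E], so with n covers the sum is 1 - n + (n - 1); the coefficient of
   [K] is chosen for this. *)
- rewrite subsumE; last exact: subset_trans sNK (joing_subl K E).
  rewrite joing_subl mul1r (eq_bigr (fun=> 1%R)) => [|P /and3P[_ sPK _]].
    by rewrite sumr_const; ring.
  by rewrite (subset_trans sPK) ?joing_subl.
move=> L sNL sLKE cL; rewrite subsumE //.
have [sKL | nsKL] := boolP (K \subset L).
  rewrite mul1r (eq_bigr (fun=> 1%R)) => [|P /and3P[_ sPK _]].
    by rewrite sumr_const; ring.
  by rewrite (subset_trans sPK).
(* Now [K] and [L] are distinct subgroups of index [p] in [K <*> E], so [K :&: L] has index [p] in
   [K]. It is the only cover of [N] below [L], and the sum is 1 - 1. *)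
have sKKE := joing_subl K E; have cKE := card_joinE grK.
have cLK : #|L| = #|K|.
  by apply/eqP; rewrite -(@eqn_pmul2l p) ?prime_gt0 // -cL cKE.
have sKLKE : K <*> L \subset K <*> E by rewrite join_subG sKKE.
have defKL : K <*> L = K <*> E.
  have [/= DK | //] := prime_index_max p_pr (joing_subl K L) sKLKE cKE.
  have sLK: L \subset K by rewrite -DK joing_subr.
  by case/negP: nsKL; rewrite (_ : K :=: L) //; apply/esym/eqP; rewrite eqEcard sLK cLK leqnn.
have cM : #|K :&: L| = (p * #|N|)%N.
  have /eqP := mul_cardG K L; rewrite -norm_joinEr; last first.
    have sLH : L \subset H by rewrite (subset_trans sLKE) // join_subG sKH.
    exact: subset_trans sLH (sub_abelian_norm abH sKH).
  rewrite defKL cKE cLK mulnAC eqn_pmul2r // cK expnS expn1 -mulnA eqn_pmul2l ?prime_gt0 //.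
  by move/eqP.
have cvM : covers p K N (K :&: L)%G.
  by rewrite /covers /= subsetIl subsetI sNK sNL cM eqxx.
rewrite (bigD1 _ cvM) /= subsetIr big1 ?(negPf nsKL).
  by rewrite mul0r addr0 subrr.
move=> P /andP[/and3P[_ sPK /eqP cP] nPM]; case sPL: (P \subset L) => //.
case/eqP: nPM; apply/val_inj/eqP.
by rewrite eqEcard subsetI sPK sPL /= cM cP leqnn.
Qed.

(** By the modular law [(S <*> E) :&: G] is a complement of [E] in [S <*> E], and so is [S]. *)
Lemma card_mod_graph (S : {group T}) : graph S -> #|(S <*> E) :&: G| = #|S|.
Proof.
move=> grS; have /and3P[_ sSH /eqP tiSE] := grS.
have sQH : S <*> E \subset H by rewrite join_subG sSH.
have sEQ : E \subset S <*> E := joing_subr S E.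
have defQ : ((S <*> E) :&: G) * E = S <*> E.
  rewrite group_modr //; case/dprodP: (defH) => _ -> _ _.
  exact/setIidPl.
have tiQ : (S <*> E) :&: G :&: E = 1.
  by rewrite -setIA tiGE; apply/trivgP; rewrite subsetIr.
have /eqP := TI_cardMg tiQ.
by rewrite defQ card_joinE // cardE mulnC eqn_pmul2r ?prime_gt0 // => /eqP.
Qed.

(** [G] has prime index in [H], so [G] and [S] generate [H], and the product formula gives the index
    of [S :&: G]. *)
Lemma card_graph_capG (S : {group T}) :
  graph S -> ~~ (S \subset G) -> #|S| = (p * #|S :&: G|)%N.
Proof.
case/and3P=> _ sSH _ nsSG.
have cH : #|H| = (p * #|G|)%N by rewrite -(dprod_card defH) cardE mulnC.
have sGSH : G <*> S \subset H by rewrite join_subG sGH.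
have [/= DG | /= DH] := prime_index_max p_pr (joing_subl G S) sGSH cH.
  by case/negP: nsSG; rewrite -DG joing_subr.
have /eqP := mul_cardG G S; rewrite -norm_joinEr; last first.
  exact: subset_trans sSH (sub_abelian_norm abH sGH).
rewrite DH cH (mulnC #|G|) mulnAC eqn_pmul2r // setIC => /eqP //.
Qed.

(** [E] has prime order, so if [X] were not a graph it would contain [E], hence [A <*> E], which has
    the same order as [X]. *)
Lemma graph_join_neq (A X : {group T}) :
  graph A -> A \subset X -> X \subset H -> #|X| = (p * #|A|)%N ->
  X :!=: A <*> E -> graph X.
Proof.
move=> grA sAX sXH cX; apply: contraR.
rewrite /graph groupP sXH /= setIC => ntXE.
have sEX : E \subset X by apply: contraR ntXE => nsEX; rewrite prime_TIg ?cardE.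
by rewrite eq_sym eqEcard join_subG sAX sEX card_joinE // cX leqnn.
Qed.

(* In R E / (S :&: G) = C_p^3, S and S E :&: G are lines spanning the plane S E
   together with E, and the X are the planes meeting S E exactly in them. *)
Lemma pencil_rel (S R : {group T}) :
  graph S -> ~~ (S \subset G) -> graph R -> S \subset R ->
  #|R| = (p * #|S|)%N ->
  let S' := ((S <*> E) :&: G)%G in
  let P A := [pred X | covers p (R <*> E) A X & X != (S <*> E)%G] in
  graph_gen (zsingle S - zsingle S' - \sum_(X | P S X) zsingle X
             + \sum_(X | P S' X) zsingle X)%R.
Proof.
move=> grS nsSG grR sSR cR S' P.
have /and3P[_ sRH tiRE] := grR; have sSH := subset_trans sSR sRH.
have sKH : R <*> E \subset H by rewrite join_subG sRH.
have sQK : S <*> E \subset R <*> E by rewrite genS ?setSU.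
have sSQ : S \subset S <*> E := joing_subl S E.
have sS'Q : S' \subset S <*> E := subsetIl _ G.
have sEQ : E \subset S <*> E := joing_subr S E.
have sEK := subset_trans sEQ sQK.
have cS' : #|S'| = #|S| := card_mod_graph grS.
have grS' : graph S' := sub_graph (subsetIr _ G).
have cQ := card_joinE grS; have cK := card_joinE grR.
have sNS' : S :&: G \subset S' by rewrite setSI.
(* A p-th power lies in [G] by [expgG], and it is a p-th power from [R], so it lies in [S] because
   [R / S] has order [p]. *)
have pK x : x \in R <*> E -> x ^+ p \in S :&: G.
  move=> Kx; rewrite inE expgG ?(subsetP sKH) // andbT.
  have /imsetP[r Rr ->] := expg_mulE sRH Kx.
  have nSR : R \subset 'N(S) := subset_trans sRH (sub_abelian_norm abH sSH).
  have cRS : #|R / S| = p.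
    by rewrite card_quotient // -divgS // cR mulnK.
  apply: coset_idr; first by rewrite groupX ?(subsetP nSR).
  rewrite morphX ?(subsetP nSR) //= -[RHS](@expg_cardG _ (R / S) (coset S r)).
    by rewrite cRS.
  exact: mem_quotient.
have Phase (A : {group T}) X : S :&: G \subset A -> graph A -> #|A| = #|S| ->
    A \subset S <*> E -> P A X -> [&& graph X, S :&: G \subset X & X \subset R <*> E].
  move=> sNA grA cA sAQ /andP[/and3P[sAX sXK /eqP cX] nXQ].
  rewrite sXK (subset_trans sNA) // !andbT.
  have DQ : A <*> E = S <*> E.
    apply/eqP; rewrite eqEcard join_subG sAQ sEQ /=.
    by rewrite !card_joinE // cA.
  apply: graph_join_neq sAX (subset_trans sXK sKH) _ _; rewrite ?DQ //.
(* The terms are regrouped into the same expression for [S] and for [S']; it remains to see that the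
   two agree at each tested [L]. *)
have subsumE (L : {group T}) :
    subsum (zsingle S - zsingle S' - \sum_(X | P S X) zsingle X
             + \sum_(X | P S' X) zsingle X)%R L =
    (((S \subset L)%:R - \sum_(X | P S X) (X \subset L)%:R)
      - ((S' \subset L)%:R - \sum_(X | P S' X) (X \subset L)%:R))%R.
  have sumP A : (subsum (\sum_(X | P A X) zsingle X) L =
      \sum_(X | P A X) (X \subset L)%:R)%R.
    by rewrite subsum_sum; apply: eq_bigr => X _; exact: subsum_single.
  rewrite !subsumD !subsumN !subsum_single !sumP; ring.
apply: (@graph_gen_intro (R <*> E) (S :&: G)).
- exact: subset_trans (subsetIl S G) (subset_trans sSQ sQK).
- by [].
- by [].
- by rewrite cK cR (card_graph_capG grS nsSG) !expnS expn0 muln1 -!mulnA.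
- have supS (A : {group T}) : S :&: G \subset A -> graph A -> A \subset S <*> E ->
     [&& graph A, S :&: G \subset A & A \subset R <*> E].
    by move=> -> -> /subset_trans->.
  move=> X; rewrite !ffunE.
  have [-> _ | nXS] := eqVneq X S; first by apply: supS; rewrite ?subsetIl.
  have [-> _ | nXS'] := eqVneq X S'; first exact: supS.
  rewrite subr0 add0r; set u := (\sum_(X | P S X) _)%R; set v := (\sum_(X | _) _)%R.
  have [u0 | nu _] := eqVneq (u X) 0%R.
    rewrite u0 oppr0 add0r => /supp_sum/hasP[Y _ /andP[PY]].
    by rewrite zsingle_neq0 => /eqP->; apply: Phase PY.
  have /supp_sum/hasP[Y _ /andP[PY]] := nu.
  by rewrite zsingle_neq0 => /eqP->; apply: Phase PY; rewrite ?subsetIl.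
(* At [R <*> E] all terms count, so the two sums must have equally many terms. *)
- have cardP (A : {group T}) : S :&: G \subset A -> A \subset S <*> E ->
      #|A| = #|S| -> (#|P A| * (#|S <*> E| - #|S|) = #|R <*> E| - #|S <*> E|)%N.
    move=> sNA sAQ cA; rewrite -[in LHS]cA.
    apply: (@card_covers _ p (R <*> E)%G A (S <*> E)%G) => //.
    - exact: abelianS abH.
    - by move=> x /pK; apply/subsetP.
    by rewrite /covers /= sAQ sQK cA cQ eqxx.
  have ePS : #|P S| = #|P S'|.
    apply/eqP; rewrite -(@eqn_pmul2r (#|S <*> E| - #|S|)).
      by rewrite !cardP ?subsetIl.
    by rewrite subn_gt0 cQ -{1}[#|S|]mul1n ltn_pmul2r ?prime_gt1.
  have sumK (A : {group T}) :
      (\sum_(X | P A X) (X \subset R <*> E)%:R = #|P A|%:R :> int)%R.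
    rewrite -sumr_const; apply: eq_bigr => X /andP[/and3P[_ sXK _] _].
    by rewrite sXK.
  by rewrite (subsumE (R <*> E)%G) !sumK ePS (subset_trans sSQ) ?(subset_trans sS'Q) ?subrr.
move=> L sNL sLK cL; rewrite subsumE.
have cLQ : #|L| = #|S <*> E|.
  by apply/eqP; rewrite -(@eqn_pmul2l p) ?prime_gt0 // -cL cK cR cQ eqxx.
(* All [X] in the sum have the order of [L], so only [X = L] can lie below [L]. It occurs exactly
   when [L] contains [A] and differs from [S <*> E], and then it cancels the term of [A]. *)
have pencil (A : {group T}) : A \subset S <*> E -> #|A| = #|S| ->
    ((A \subset L)%:R - \sum_(X | P A X) (X \subset L)%:R = (L == S <*> E :> {set T})%:R :> int)%R.
  move=> sAQ cA; have [sAL | nsAL] := boolP (A \subset L); last first.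
    rewrite big1 => [|X /andP[/and3P[sAX _ _] _]].
      by case: eqP => // DL; rewrite DL sAQ in nsAL.
    by case: (boolP (X \subset L)) => // /(subset_trans sAX); rewrite (negPf nsAL).
  have [DL | nLQ] := eqVneq (L :> {set T}) (S <*> E).
    rewrite big1 ?subr0 // => X /andP[/and3P[_ _ /eqP cX]].
    rewrite -val_eqE eqEcard /= cX cA cQ leqnn andbT DL => /negPf.
    by move->.
  have PL : P A L.
    by rewrite /P /covers /= sAL sLK cLQ cQ cA eqxx.
  rewrite (bigD1 L) //= subxx big1 ?addr0 ?subrr // => X.
  case/andP=> /andP[/and3P[_ _ /eqP cX] _].
  by rewrite -val_eqE eqEcard /= cX cA cLQ cQ leqnn andbT => /negPf->.
by rewrite !pencil // subrr.
Qed.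

(** * Reduction of graphs to basic ones *)

Definition basic (S : {set T}) :=
  graph S && (cyclic (H / S) || (S \subset G) && cyclic (G / S)).

Definition reducible (v : zcomb T) :=
  exists u : zcomb T,
    (forall S, u S != 0%R -> basic S) /\ in_zspan graph_gen (v - u)%R.

Lemma reducible0 : reducible 0%R.
Proof.
exists 0%R; split=> [S|]; first by rewrite ffunE eqxx.
by rewrite subr0; apply: in_zspan0.
Qed.

Lemma reducible_basic S : basic S -> reducible (zsingle S).
Proof.
move=> bS; exists (zsingle S); split=> [X|]; last by rewrite subrr; apply: in_zspan0.
by rewrite zsingle_neq0 => /eqP->.
Qed.

Lemma reducibleD u v : reducible u -> reducible v -> reducible (u + v)%R.
Proof.
move=> [u' [bu su]] [v' [bv sv]]; exists (u' + v')%R; split=> [S|].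
  rewrite ffunE; have [u0 | /bu-> //] := eqVneq (u' S) 0%R.
  by rewrite u0 add0r => /bv.
by rewrite opprD addrACA; apply: in_zspanD.
Qed.

Lemma reducibleMz u c : reducible u -> reducible (u *~ c)%R.
Proof.
move=> [u' [bu su]]; exists (u' *~ c)%R; split=> [S|].
  rewrite ffunMzE => nz; apply: bu; apply: contraNneq nz => ->.
  by rewrite mul0rz.
by rewrite -mulrzBl; apply: in_zspanMz.
Qed.

Lemma reducible_sum (I : finType) (P : pred I) (F : I -> zcomb T) :
  (forall i, P i -> reducible (F i)) -> reducible (\sum_(i | P i) F i)%R.
Proof. exact: (big_ind _ reducible0 reducibleD). Qed.

Lemma reducible_mod u v : graph_gen (u - v)%R -> reducible v -> reducible u.
Proof.
move=> guv [w [bw sw]]; exists w; split=> //.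
by rewrite -(subrK v u) -addrA; apply: in_zspanD => //; apply: in_zspan_gen.
Qed.

Lemma reducible_graph (S : {group T}) : graph S -> reducible (zsingle S).
Proof.
have [n] := ubnP (#|H| - #|S|)%N; elim: n S => // n IHn S ltn grS.
have sSH : S \subset H by case/and3P: grS.
have {}IHn (X : {group T}) : (#|S| < #|X|)%N -> graph X -> reducible (zsingle X).
  move=> ltSX grX; apply: IHn => //; rewrite ltnS in ltn.
  apply: leq_trans ltn; apply: (ltn_sub2l _ ltSX).
  by apply: (leq_trans ltSX); apply: subset_leq_card; case/and3P: grX.
have lt_p m : (0 < m)%N -> (m < p * m)%N.
  by move=> m0; rewrite -{1}[m]mul1n ltn_pmul2r ?prime_gt1.
(* This is stated for every [X] of the order of [S]: the pencil relation replaces [S] by a subgroup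
   [S'] of [G] of equal order, which the induction hypothesis does not reach. *)
have red_subG (X : {group T}) : #|X| = #|S| -> X \subset G -> reducible (zsingle X).
  move=> cX sXG; have grX := sub_graph sXG.
  have [cyc | ncyc] := boolP (cyclic (G / X)).
    by apply: reducible_basic; rewrite /basic grX sXG cyc orbT.
  have [K [sXK sKG pK cK]] :=
    noncyclic_quotient_plane p_pr (abelianS sGH abH) (pgroupS sGH pH) sXG ncyc.
  have := plane_rel sXK sKG pK cK.
  have Dw (a b d : zcomb T) : (a - b + d = a - (b + d *~ -1))%R.
    by rewrite mulrN1z !opprD opprK !addrA.
  rewrite Dw => gen_plane; apply: reducible_mod gen_plane _.
  apply: reducibleD.
    apply: reducible_sum => P /and3P[_ sPK /eqP cP]; apply: IHn.
      by rewrite cP cX lt_p.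
    exact: sub_graph (subset_trans sPK sKG).
  do 2!apply: reducibleMz; apply: IHn; last exact: sub_graph sKG.
  rewrite cK cX expnS expn1 -mulnA (ltn_trans (lt_p _ (cardG_gt0 S))) // lt_p //.
  by rewrite muln_gt0 prime_gt0 ?cardG_gt0.
have [sSG | nsSG] := boolP (S \subset G); first exact: red_subG.
have [cyc | ncyc] := boolP (cyclic (H / S)).
  by apply: reducible_basic; rewrite /basic grS cyc.
have [K [sSK sKH pK cK]] := noncyclic_quotient_plane p_pr abH pH sSH ncyc.
have cQ := card_joinE grS.
(* Since [S <*> E] has order only [p] times that of [S], it cannot contain [K]. Adjoining such an
   [x] to [S] gives a cover other than [S <*> E], hence a graph. *)
have [x Kx nQx] : exists2 x, x \in K & x \notin S <*> E.
  apply/subsetPn; apply/negP=> /subset_leq_card; rewrite cQ cK expnS -mulnA.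
  by rewrite expn1 leq_pmul2l ?prime_gt0 // leqNgt lt_p.
have nSx : x \notin S by apply: contra nQx; apply/subsetP/joing_subl.
have /and3P[sSR sRK /eqP cR] :=
  covers_join p_pr (abelianS sKH abH) sSK Kx nSx (pK x Kx).
have sRH := subset_trans sRK sKH.
have grR : graph (S <*> <[x]>)%G.
  apply: (graph_join_neq grS sSR sRH cR).
  by apply: contraNneq nQx => <-; rewrite -cycle_subG joing_subr.
have /= := pencil_rel grS nsSG grR sSR cR.
set Q := (S <*> E)%G; set S' := (Q :&: G)%G => pencil.
have cS' : #|S'| = #|S| := card_mod_graph grS.
have sS'G : S' \subset G := subsetIr _ G.
have grS' : graph S' := sub_graph sS'G.
have red_pencil (A : {group T}) : graph A -> #|A| = #|S| -> A \subset Q ->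
    reducible (\sum_(X | covers p (S <*> <[x]> <*> E) A X && (X != Q)) zsingle X)%R.
  move=> grA cA sAQ; apply: reducible_sum => X /andP[/and3P[sAX sXK /eqP cX] nXQ].
  apply: IHn; first by rewrite cX cA lt_p.
  have sXH : X \subset H.
    by apply: subset_trans sXK _; rewrite join_subG sRH.
  apply: (graph_join_neq grA sAX sXH cX).
  apply: contraNneq nXQ => DX; rewrite -val_eqE /= DX eqEcard join_subG sAQ.
  by rewrite joing_subr !card_joinE // cA leqnn.
have Dw (a b c d : zcomb T) : (a - b - c + d = a - (b + (c + d *~ -1)))%R.
  by rewrite mulrN1z !opprD opprK !addrA.
rewrite Dw in pencil; apply: reducible_mod pencil _.
apply: reducibleD; first exact: red_subG.
apply: reducibleD; first by apply: red_pencil => //; apply: joing_subl.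
by apply/reducibleMz/red_pencil => //; apply: subsetIl.
Qed.

(** * Independence of basic graphs and conclusion for split groups *)

Lemma basic_independent (u : zcomb T) :
  (forall S, u S != 0%R -> basic S) ->
  (forall L : {group T}, L \subset H -> cyclic (H / L) -> subsum u L = 0%R) ->
  u = 0%R.
Proof.
move=> bu f0; suff u0 n (S : {group T}) : (#|S| < n)%N -> u S = 0%R.
  apply/ffunP=> A; rewrite ffunE; apply/eqP/negPn/negP=> nzA.
  have /andP[/and3P[gA _ _] _] := bu A nzA.
  by rewrite -[A]/(gval (Group gA)) (u0 _ _ (ltnSn _)) eqxx in nzA.
elim: n S => // n IHn S; rewrite ltnS => leSn.
have {leSn}IHn (X : {group T}) : (#|X| < #|S|)%N -> u X = 0%R.
  by move=> ltXS; apply: IHn; apply: leq_trans ltXS leSn.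
(* Proper subgroups of [X] are smaller than [S], so the sum of [u] below [X] is just [u X]. *)
have cyc0 (X : {group T}) : #|X| = #|S| -> X \subset H -> cyclic (H / X) -> u X = 0%R.
  move=> cX sXH cycX; rewrite -(f0 X sXH cycX) /subsum (bigD1 X) //= big1 ?addr0 //.
  move=> Y /andP[sYX nYX]; apply: IHn; rewrite -cX; apply: proper_card.
  by rewrite properEneq -val_eqE in nYX *; rewrite nYX.
apply/eqP/negPn/negP=> nzS; have := bu S nzS.
case/andP=> grS /orP[cycS | /andP[sSG cycS]].
  by case/eqP: nzS; apply: cyc0 => //; case/and3P: grS.
have sSH := subset_trans sSG sGH.
have sLH : S <*> E \subset H by rewrite join_subG sSH.
have defSG : (S <*> E) :&: G = S.
  apply/esym/eqP; rewrite eqEcard subsetI joing_subl sSG /=.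
  by rewrite (card_mod_graph grS) leqnn.
(* As [H = G * E], this quotient is the image of [G], isomorphic to [G / S] by [defSG]. *)
have cycL : cyclic (H / (S <*> E)).
  have nLG : G \subset 'N(S <*> E).
    exact: subset_trans sGH (sub_abelian_norm abH sLH).
  suff -> : H / (S <*> E) = G / (S <*> E).
    by rewrite -(isog_cyclic (second_isog nLG)) defSG.
  case/dprodP: defH => _ <- _ _; rewrite quotientMl //.
  by rewrite (quotientS1 (joing_subr S E)) mulg1.
(* A graph [X] below [S <*> E] has order at most that of [S]. In case of equality either [cyc0]
   applies, or [X] lies in [(S <*> E) :&: G = S] and equals [S]. *)
case/eqP: nzS; rewrite -(f0 _ sLH cycL) /subsum (bigD1 S) ?joing_subl //=.
rewrite big1 ?addr0 // => X /andP[sXL nXS].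
apply/eqP/negPn/negP=> nzX; have /andP[grX bX] := bu X nzX.
have leXS : (#|X| <= #|S|)%N.
  rewrite -(@leq_pmul2l p) ?prime_gt0 // -!card_joinE //.
  by apply: subset_leq_card; rewrite join_subG sXL joing_subr.
have [cX | nX] := eqVneq #|X| #|S|; last first.
  by rewrite IHn ?eqxx // ltn_neqAle nX in nzX.
case/orP: bX => [cycX | /andP[sXG _]].
  by rewrite cyc0 ?eqxx // in nzX; apply: subset_trans sXL sLH.
case/eqP: nXS; apply/val_inj/eqP; rewrite eqEcard cX leqnn andbT.
have : X \subset (S <*> E) :&: G by rewrite subsetI sXL.
by rewrite defSG.
Qed.

(** Modulo generators [theta] becomes a basic combination [u], whose sums still vanish because the
    generators are relations; independence then forces [u = 0]. *)
Lemma graph_rel_in_span (theta : zcomb T) :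
  graph_rel theta -> in_zspan graph_gen theta.
Proof.
move=> [Btheta gr_theta].
have [u [bu su]] : reducible theta.
  rewrite [theta]zcomb_single; apply: reducible_sum => S _.
  have [-> | /gr_theta grS] := eqVneq (theta S) 0%R.
    by rewrite mulr0z; apply: reducible0.
  apply: reducibleMz; have /andP[gS _] := grS.
  by have := @reducible_graph (Group gS) grS.
suff u0 : u = 0%R by rewrite u0 subr0 in su.
apply: basic_independent => // L sLH cycL.
have subsum_rel v : brauer_rel H v -> subsum v L = 0%R.
  by move=> Bv; apply: (brauer_relP abH pH (proj1 Bv)).1.
have [m [c [g [gen_g Du]]]] := su.
have -> : u = (theta - \sum_(i < m) g i *~ c i)%R by rewrite -Du opprB addrC subrK.
rewrite subsumD subsumN subsum_sum subsum_rel // big1 ?subr0 // => i _.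
by rewrite subsumMz subsum_rel ?mul0rz //; case: (gen_g i) => [[]].
Qed.

End SplitGroup.

(** * Graphs of homomorphisms and transfer to G x C *)

(** Trivial intersection with 1 x C makes the first projection injective on [S], so the second
    coordinate is a function of the first. *)
Lemma is_graphP (gT cT : finGroupType) (G : {group gT}) (C : {group cT})
    (S : {set (gT * cT)%type}) :
  is_graph G C S <-> graph (setX_group G C) (setX_group 1 C) S.
Proof.
split=> [[K [rho [sKG sKC ->]]] | /and3P[gS sSGC /eqP tiS]].
  have memS k : k \in K -> (k, rho k) \in [set (k, rho k) | k in K].
    by move=> Kk; apply/imsetP; exists k.
  have gS : group_set [set (k, rho k) | k in K].
    apply/group_setP; split; first by have := memS 1 (group1 K); rewrite morph1.
    move=> _ _ /imsetP[x Kx ->] /imsetP[y Ky ->].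
    have -> : (x, rho x) * (y, rho y) = (x * y, rho (x * y)) by rewrite morphM.
    by rewrite memS ?groupM.
  apply/and3P; split=> //.
    apply/subsetP=> _ /imsetP[x Kx ->]; rewrite inE /= (subsetP sKG) //.
    by rewrite (subsetP sKC) // mem_morphim.
  apply/eqP/(@trivgP _ (Group gS :&: setX_group 1 C)%G)/subsetP=> _ /setIP[/imsetP[x Kx ->]].
  by rewrite !inE /= => /andP[/eqP-> _]; rewrite morph1.
pose H := Group gS; have tiH : H :&: setX 1 C = 1 by [].
have inj1 x y : x \in H -> y \in H -> x.1 = y.1 -> x = y.
  move=> Hx Hy exy; apply/eqP; rewrite eq_mulVg1; apply/eqP/set1gP.
  have Hxy : x^-1 * y \in H by rewrite groupM ?groupV.
  rewrite -tiH inE Hxy inE /= exy mulVg set11 /=.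
  by have := subsetP sSGC _ Hxy; rewrite inE => /andP[].
(* The picked element is the unique one of [H] over [k]; the default 1 is reached only outside the
   projection [K]. *)
pose rho k := (odflt 1 [pick x in H | x.1 == k]).2.
have rhoE x : x \in H -> rho x.1 = x.2.
  move=> Hx; rewrite /rho; case: pickP => [y /andP[Hy /eqP exy] | /(_ x)] /=.
    by rewrite (inj1 y x).
  by rewrite Hx eqxx.
pose K := (fst_morphism gT cT @* H)%G.
have KP k : k \in K -> exists2 x, x \in H & k = x.1.
  by case/morphimP=> x _ Hx ->; exists x.
have rhoM : {in K &, {morph rho : x y / x * y}}.
  move=> _ _ /KP[x Hx ->] /KP[y Hy ->].
  by rewrite -[x.1 * y.1]/((x * y).1) !rhoE ?groupM.
have KH x : x \in H -> x.1 \in K.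
  by move=> Hx; apply: (mem_morphim (fst_morphism gT cT)); rewrite ?inE.
have inGC x : x \in H -> (x.1 \in G) && (x.2 \in C).
  by move=> Hx; have := subsetP sSGC _ Hx; rewrite inE.
exists K, (Morphism rhoM); split.
- by apply/subsetP=> _ /KP[x /inGC/andP[Gx _] ->].
- by apply/subsetP=> _ /morphimP[_ _ /KP[x Hx ->] ->] /=; rewrite rhoE //; case/andP: (inGC x Hx).
apply/setP=> x; apply/idP/imsetP=> [Sx | [_ /KP[y Hy ->] ->]] /=.
  by exists x.1; rewrite ?KH //= rhoE //; case: (x).
by rewrite rhoE //; case: (y) Hy.
Qed.

(** Elementary abelian p-groups of equal order are isomorphic, so this matches [graph_gen] with the
    isomorphism in [kprime_gen]. *)
Lemma abelem_cube (cT : finGroupType) (p : nat) (C : {group cT}) :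
  prime p -> #|C| = p ->
  p.-abelem (setX (setX C C) C) /\ #|setX (setX C C) C| = (p ^ 3)%N.
Proof.
move=> p_pr cC; split; last by rewrite !cardsX cC !expnS expn0 muln1 mulnA.
have abelC : p.-abelem C by rewrite prime_abelem.
have /(abelemP p_pr)[abC expC] := abelC.
apply/(@abelemP _ _ (setX_group (setX_group C C) C) p_pr); split=> /=.
  apply/centsP=> -[[a b] c] /setXP[/setXP[/= Ca Cb] /= Cc] [[a' b'] c'].
  case/setXP=> [/setXP[/= Ca' Cb'] /= Cc'].
  by congr (_, _, _); apply: (centsP abC).
move=> [[a b] c] /setXP[/setXP[/= Ca Cb] /= Cc].
have expE n : (a, b, c) ^+ n = (a ^+ n, b ^+ n, c ^+ n).
  by elim: n => // n IHn; rewrite !expgS IHn.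
by rewrite expE !expC.
Qed.

Theorem theorem1p1 (gT cT : finGroupType) (p : nat)
  (G : {group gT}) (C : {group cT}) :
  prime p -> abelian G -> (p.-group G)%g -> #|C| = p ->
  forall theta : zcomb (gT * cT)%type,
    rel_brauer G C theta -> in_zspan (kprime_gen G C) theta.
Proof.
move=> p_pr abG pG cC theta.
have relP u : rel_brauer G C u <-> graph_rel (setX_group G C) (setX_group 1 C) u.
  by split=> -[Bu gru]; split=> // S /gru/is_graphP.
have [abelC3 cC3] := abelem_cube p_pr cC.
have defGC : setX_group G 1 \x setX_group 1 C = setX_group G C := setX_dprod G C.
have abGC : abelian (setX_group G C).
  have abC : abelian C by apply: cyclic_abelian; rewrite prime_cyclic ?cC.
  apply/centsP=> -[a b] /setXP[/= Ga Cb] [a' b'] /setXP[/= Ga' Cb'].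
  by congr (_, _); [apply: (centsP abG) | apply: (centsP abC)].
have pGC : p.-group (setX_group G C).
  by rewrite /pgroup /= cardsX pnatM cC pnat_id // andbT.
have cE : #|@setX_group gT cT 1 C| = p by rewrite /= cardsX cards1 mul1n.
move/relP/(graph_rel_in_span p_pr abGC pGC defGC cE); apply: in_zspan_mono.
move=> v [/relP Rv [K [N [sNK sKH [abelKN cKN] ex]]]]; split=> //.
exists K, N; split=> //.
by rewrite (isog_abelem_card _ abelKN) abelC3 cC3 cKN eqxx.
Qed.
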